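(* Let $\mathcal X$ be a finite alphabet and $P_0,P_1,\hat P_0,\hat P_1$ distributions on $\mathcal X$ with full support. Observations $\mathbf x\in\mathcal X^n$ are i.i.d. from $P_0$ or $P_1$, and for a threshold $\hat\gamma$ (possibly depending on $n$) the mismatched likelihood ratio test decides hypothesis $1$ iff $D(\hat T\|\hat P_0)-D(\hat T\|\hat P_1)\ge\hat\gamma$, where $\hat T$ is the type of $\mathbf x$; $\epsilon_0$ (resp. $\epsilon_1$) is the probability under $P_0^n$ (resp. $P_1^n$) of deciding $1$ (resp. $0$). Fix $\epsilon\in(0,\tfrac12)$ and define the mismatched Stein exponent $\hat E_1^{(\epsilon)}$ as the supremum, over threshold sequences $(\hat\gamma_n)$ with $\limsup_{n\to\infty}\epsilon_0\le\epsilon$, of $\liminf_{n\to\infty}-\frac1n\log\epsilon_1$. Let $\gamma^*=D(P_0\|\hat P_0)-D(P_0\|\hat P_1)$ and $\hat{\mathcal Q}_1=\{Q\in\mathcal P(\mathcal X):D(Q\|\hat P_0)-D(Q\|\hat P_1)\le\gamma^*\}$. Then $$\hat E_1^{(\epsilon)}=\min_{Q\in\hat{\mathcal Q}_1}D(Q\|P_1),$$ and this is achieved by the threshold $$\hat\gamma_n=D(P_0\|\hat P_0)-D(P_0\|\hat P_1)+\sqrt{\frac{V(P_0,\hat P_0,\hat P_1)}{n}}\,\mathsf Q^{-1}(\epsilon),$$ where $V(P_0,\hat P_0,\hat P_1)=\mathrm{Var}_{P_0}\big[\log\frac{\hat P_0(X)}{\hat P_1(X)}\big]$ with $X\sim P_0$,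 and $\mathsf Q^{-1}$ is the inverse of the Gaussian tail function $\mathsf Q(t)=\Pr[Z>t]$, $Z\sim\mathcal N(0,1)$.
   Context: $D(\cdot\|\cdot)$ is relative entropy; $\mathcal P(\mathcal X)$ is the probability simplex; the type $\hat T$ of $\mathbf x$ is its empirical distribution.
   Formalization: The formal statement assumes V(P_0,P̂_0,P̂_1)>0. If V=0 then P̂_0=P̂_1, the statistic and the proposed threshold are identically 0, the test always decides 1 and ε_0=1>ε, so the claimed achievability fails (the exponent formula alone reads 0=0). *)

(* Defs.v *)
From HB Require Import structures.
From mathcomp Require Import all_boot all_order all_algebra.
From mathcomp Require Import all_classical all_reals all_analysis.
Set Implicit Arguments. Unset Strict Implicit. Unset Printing Implicit Defensive.
Import Order.TTheory GRing.Theory Num.Theory.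
Local Open Scope ring_scope.
Local Open Scope classical_set_scope.

Section Defs.
Variables (R : realType) (X : finType).

Definition is_dist (P : X -> R) : Prop :=
  (forall a, 0 <= P a) /\ \sum_(a : X) P a = 1.

Definition full_dist (P : X -> R) : Prop :=
  (forall a, 0 < P a) /\ \sum_(a : X) P a = 1.

(* relative entropy in nats (convention 0 log 0 = 0; note ln 0 = 0 in the
   library and the term carries a factor Q a = 0 anyway) *)
Definition KL (Q P : X -> R) : R := \sum_(a : X) Q a * ln (Q a / P a).

Definition etype (n : nat) (x : n.-tuple X) : X -> R :=
  fun a => (count_mem a x)%:R / n%:R.

Definition prodP (P : X -> R) (n : nat) (x : n.-tuple X) : R :=
  \prod_(i < n) P (tnth x i).

Definition decide1 (Ph0 Ph1 : X -> R) (g : R) (n : nat) (x : n.-tuple X) : bool :=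
  g <= KL (etype x) Ph0 - KL (etype x) Ph1.

Definition err0 (P0 Ph0 Ph1 : X -> R) (g : R) (n : nat) : R :=
  \sum_(x : n.-tuple X | decide1 Ph0 Ph1 g x) prodP P0 x.

Definition err1 (P1 Ph0 Ph1 : X -> R) (g : R) (n : nat) : R :=
  \sum_(x : n.-tuple X | ~~ decide1 Ph0 Ph1 g x) prodP P1 x.

Definition admissible (P0 Ph0 Ph1 : X -> R) (eps : R) (gam : nat -> R) : Prop :=
  (limn_esup (fun n => (err0 P0 Ph0 Ph1 (gam n) n)%:E) <= eps%:E)%E.

Definition exponent1 (P1 Ph0 Ph1 : X -> R) (gam : nat -> R) : \bar R :=
  limn_einf (fun n => (- (n%:R)^-1 * ln (err1 P1 Ph0 Ph1 (gam n) n))%:E).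

Definition stein_exp (P0 P1 Ph0 Ph1 : X -> R) (eps : R) : \bar R :=
  ereal_sup [set exponent1 P1 Ph0 Ph1 gam | gam in admissible P0 Ph0 Ph1 eps].

Definition Vdisp (P0 Ph0 Ph1 : X -> R) : R :=
  let f := fun a => ln (Ph0 a / Ph1 a) in
  let m := \sum_(a : X) P0 a * f a in
  \sum_(a : X) P0 a * (f a - m) ^+ 2.

End Defs.

Definition gaussQ {R : realType} (t : R) : R :=
  fine (normal_prob 0 1 [set u : R | t < u]).

(* inverse of Q: the (unique, since Q is a decreasing bijection R -> (0,1))
   t with Q t = eps *)
Definition gaussQinv {R : realType} (eps : R) : R :=
  xget 0 [set t : R | gaussQ t = eps].

(* Main.v *)
(* Write g = ln (Ph1 / Ph0).  The test decides 1 iff the empirical mean of g is at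
   least the threshold, and gstar is the mean of g under P0.
   Converse: by the weak law under P0, an admissible threshold is eventually above
   gstar - d for every d > 0, and a change of measure to any Q with E_Q[g] < gstar
   bounds the exponent by KL Q P1.  Achievability: the minimiser is an exponential
   tilt of P1, whose parameter is the optimal one in Chernoff's bound, and that
   bound is continuous in the threshold.
   Admissibility of the Gaussian threshold needs the central limit theorem, proved
   by Stein's method: the solution of f' x - x f x = [t < x] - gaussQ t is explicit
   in terms of the Mills ratio, and x f x is Lipschitz. *)
Require Import Defs.
From HB Require Import structures.
From mathcomp Require Import all_boot all_order all_algebra.
From mathcomp Require Import all_classical all_reals all_analysis.
From mathcomp Require Import ring lra.
Set Implicit Arguments. Unset Strict Implicit. Unset Printing Implicit Defensive.
Import Order.TTheory GRing.Theory Num.Theory.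
Import numFieldNormedType.Exports.
Local Open Scope ring_scope.
Local Open Scope classical_set_scope.

(** * Gaussian tails and the Mills ratio *)

(** Only an upper bound on [err0] is required, so the central limit theorem is proved in one
    direction, and the solution f of Stein's equation needs only lower bounds on its increments. On
    either side of t, f' x is x f x plus a constant, so the Lipschitz constant of x f x plays the
    role of a bound on f''; the kink at t is met by comparing increments instead of derivatives.
    Expectations are finite sums, obtained by iterating a one-letter averaging operator; the
    Gaussian measure enters only through the derivative and the two limits of its tail. For the
    exponent, with u = g - gstar, the number - ln (sum of P1 exp (- l u)) ties the two halves
    together: it bounds KL Q P1 from below on the constraint set, is attained at the optimal tilt,
    and is the Chernoff exponent. The converse only reaches full-support Q strictly inside the
    constraint, so the minimiser has to be approached from inside. *)

Section Mills.
Variables (R : realType) (c : R) (G : R -> R).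
Hypothesis c_gt0 : 0 < c.
Hypothesis derG : forall x : R, is_derive x 1 G (- (c * expR (- (x ^+ 2 / 2)))).
Hypothesis cvgG : G x @[x --> +oo] --> (0 : R).

Definition mills (x : R) : R := c^-1 * G x * expR (x ^+ 2 / 2).

Lemma is_derive_expR_sqr (k x : R) :
  is_derive x 1 (fun y => expR (k * (y ^+ 2 / 2))) (k * x * expR (k * (x ^+ 2 / 2))).
Proof.
have h : is_derive x 1 (fun y : R => k * (y ^+ 2 / 2)) (k * x).
  by apply: is_derive_eq; rewrite /GRing.scale /=; field.
apply: (@is_derive_eq _ _ _ _ _ _ _ _ (@is_derive1_comp _ expR _ x _ _ _ h)).
by rewrite mulrC.
Qed.

Lemma is_derive_mills (x : R) : is_derive x 1 mills (x * mills x - 1).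
Proof.
have h : is_derive x 1 (fun y => expR (y ^+ 2 / 2)) (x * expR (x ^+ 2 / 2)).
  have := @is_derive_expR_sqr 1 x; rewrite !mul1r.
  by under eq_fun do rewrite mul1r.
have hG := derG x.
apply: is_derive_eq; rewrite /mills /GRing.scale /= expRN.
have c0 := lt0r_neq0 c_gt0.
have e0 := lt0r_neq0 (expR_gt0 (x ^+ 2 / 2)).
by field; rewrite c0 e0.
Qed.

(** A nonincreasing function dominates its limit at infinity. A minorant [- h] tending to 0 replaces
    the convergence of [N], so that only one side has to be estimated. *)
Lemma ge0_of_nincr_limit (N dN h : R -> R) (a : R) :
  (forall x, a <= x -> is_derive x 1 N (dN x)) ->
  (forall x, a <= x -> dN x <= 0) ->
  (forall x, a <= x -> - h x <= N x) ->
  h x @[x --> +oo] --> (0 : R) -> 0 <= N a.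
Proof.
move=> dNP dN0 hN h0.
have Ndec x : a <= x -> N x <= N a.
  move=> ax.
  have dm y : y \in `]a, x[%R -> is_derive y 1 N (dN y).
    by rewrite in_itv /= => /andP[/ltW ? _]; exact: dNP.
  have cN : {within `[a, x], continuous N}.
    apply: derivable_within_continuous => y; rewrite in_itv /= => /andP[ay _].
    by have := dNP y ay; case.
  have [y + E] := MVT_segment ax dm cN.
  rewrite in_itv /= => /andP[ay _].
  rewrite -subr_le0 E mulr_le0_ge0 ?subr_ge0//; exact: dN0.
rewrite -oppr_le0.
apply: (cvgr_to_ge h0).
near=> x.
have ax : a <= x by near: x; apply: nbhs_pinfty_ge; rewrite num_real.
by rewrite lerNl (le_trans (hN x ax))// Ndec.
Unshelve. all: by end_near. Qed.


Lemma gauss_tail_ge0 (a : R) : 0 <= G a.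
Proof.
apply: (@ge0_of_nincr_limit G _ (fun x => - G x) a (fun x _ => derG x)).
- by move=> x _; rewrite oppr_le0 mulr_ge0 ?expR_ge0 ?ltW.
- by move=> x _; rewrite opprK.
- by rewrite -oppr0; apply: cvgN.
Qed.

Lemma gauss_tail_nincr (x y : R) : x <= y -> G y <= G x.
Proof.
move=> xy.
have dm z : z \in `]x, y[%R -> is_derive z 1 G (- (c * expR (- (z ^+ 2 / 2)))) by [].
have cG : {within `[x, y], continuous G}.
  by apply: derivable_within_continuous => z _; case: (derG z).
have [z _ E] := MVT_segment xy dm cG.
rewrite -subr_le0 E mulr_le0_ge0 ?subr_ge0// oppr_le0.
by rewrite mulr_ge0 ?expR_ge0 ?ltW.
Qed.

Lemma mills_ge0 (x : R) : 0 <= mills x.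
Proof.
by rewrite /mills !mulr_ge0 ?expR_ge0 ?invr_ge0 ?gauss_tail_ge0// ltW.
Qed.

Lemma cvg_inv_pinfty (k : R) : k / x @[x --> +oo] --> (0 : R).
Proof.
rewrite -[X in _ --> X](mulr0 k); apply: cvgM; first exact: cvg_cst.
apply/gtr0_cvgV0; last exact: cvg_id.
by apply: nbhs_pinfty_gt; rewrite num_real.
Qed.

(* The functions x phi(x) / (1 + x^2) and phi(x) / x squeeze the tail G(x). *)
Lemma mills_lower (a : R) : 0 <= a -> a <= (1 + a ^+ 2) * mills a.
Proof.
move=> a0.
have p1 (x : R) : 0 < 1 + x ^+ 2 by rewrite ltr_pwDl// sqr_ge0.
pose N x := G x - c * (x * (1 + x ^+ 2)^-1 * expR (-1 * (x ^+ 2 / 2))).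
pose dN x : R := - (c * expR (- (x ^+ 2 / 2)) * 2 / (1 + x ^+ 2) ^+ 2).
have : 0 <= N a.
  apply: (@ge0_of_nincr_limit N dN (fun x => c / x)) => [x _|x _|x ax|].
  - have hG := derG x.
    have hE := @is_derive_expR_sqr (-1) x.
    have hV : is_derive x 1 (fun y : R => (1 + y ^+ 2)^-1)
        (- (1 + x ^+ 2) ^- 2 *: (2 * x)).
      apply: is_deriveV; first exact: lt0r_neq0.
      by apply: is_derive_eq; rewrite /GRing.scale /=; ring.
    apply: is_derive_eq; rewrite /dN /GRing.scale /= !mulN1r.
    by field; exact: lt0r_neq0.
  - by rewrite oppr_le0 !mulr_ge0 ?invr_ge0 ?expR_ge0 ?exprn_ge0// ltW.
  (* [c / 0] evaluates to 0, so at the origin the required bound is just 0 <= G 0. *)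
  - have [->|x0] := eqVneq x 0.
      by rewrite invr0 mulr0 oppr0 /N !mul0r mulr0 subr0 gauss_tail_ge0.
    have xp : 0 < x by rewrite lt_neqAle eq_sym x0 (le_trans a0).
    rewrite /N lerBrDl (le_trans _ (gauss_tail_ge0 x))//.
    rewrite -mulrBr pmulr_rle0// subr_le0.
    rewrite (@le_trans _ _ (x * (1 + x ^+ 2)^-1))//.
      apply: ler_piMr; first by rewrite mulr_ge0 ?invr_ge0 ?(ltW xp) ?(ltW (p1 x)).
      by rewrite mulN1r -expR0 ler_expR oppr_le0 divr_ge0 ?sqr_ge0.
    rewrite ler_pdivrMr// mulrDr mulr1 expr2 mulrA mulVf// mul1r.
    by rewrite lerDr invr_ge0 ltW.
  - exact: cvg_inv_pinfty.
rewrite /N subr_ge0 mulN1r => h.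
rewrite /mills -(ler_pM2r (expR_gt0 (- (a ^+ 2 / 2)))) -(ler_pM2l c_gt0).
rewrite -(ler_pM2l (p1 a)) in h.
apply: le_trans (le_trans h _).
  rewrite le_eqVlt; apply/orP; left; apply/eqP; field.
  exact: lt0r_neq0.
rewrite le_eqVlt; apply/orP; left; apply/eqP.
rewrite expRN; field.
by rewrite !lt0r_neq0 ?expR_gt0.
Qed.

Lemma mills_upper (a : R) : 0 < a -> a * mills a <= 1.
Proof.
move=> a0.
pose N x := c * (x^-1 * expR (-1 * (x ^+ 2 / 2))) - G x.
pose dN x : R := - (c * expR (- (x ^+ 2 / 2)) / x ^+ 2).
have : 0 <= N a.
  apply: (@ge0_of_nincr_limit N dN G) => [x ax|x ax|x ax|//].
  - have x0 : x != 0 by rewrite lt0r_neq0// (lt_le_trans a0).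
    have hG := derG x.
    have hE := @is_derive_expR_sqr (-1) x.
    have hV : is_derive x 1 (fun y : R => y^-1) (- x ^- 2 *: 1) by exact: is_deriveV.
    apply: is_derive_eq; rewrite /dN /GRing.scale /= !mulN1r.
    by field.
  - by rewrite oppr_le0 !mulr_ge0 ?invr_ge0 ?expR_ge0 ?sqr_ge0// ltW.
  - rewrite /N lerDr mulr_ge0 ?ltW// mulr_gt0 ?expR_gt0// invr_gt0.
    exact: lt_le_trans ax.
rewrite /N subr_ge0 mulN1r => h.
rewrite /mills -(ler_pM2r (expR_gt0 (- (a ^+ 2 / 2)))) -(ler_pM2l c_gt0).
rewrite -(ler_pM2l a0) in h.
apply: le_trans (le_trans h _).
  rewrite le_eqVlt; apply/orP; left; apply/eqP; rewrite expRN; field.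
  by rewrite !lt0r_neq0 ?expR_gt0.
rewrite le_eqVlt; apply/orP; left; apply/eqP; field.
exact: lt0r_neq0.
Qed.

(** The bounded quantity is the derivative of [x * mills x]. For x >= 1 it lies between 0
    ([mills_lower]) and [mills x <= 1] ([mills_upper]); between t and 1 crude bounds from |x| <= K
    suffice. Only half-lines [t, +oo) are possible, since the Mills ratio grows like exp (x^2 / 2)
    towards -oo. *)
Lemma mills_derive_bound (t : R) :
  exists2 L, 0 <= L & forall x, t <= x -> `|(1 + x ^+ 2) * mills x - x| <= L.
Proof.
pose K : R := Num.max `|t| 1.
have K1 : 1 <= K by rewrite le_max lexx orbT.
have K0 : 0 <= K by exact: le_trans K1.
pose m := c^-1 * G t * expR (K ^+ 2 / 2).
have m0 : 0 <= m.
  by rewrite !mulr_ge0 ?expR_ge0 ?invr_ge0 ?gauss_tail_ge0// ltW.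
have B0 : 0 <= (1 + K ^+ 2) * m + K.
  by apply: addr_ge0 => //; apply: mulr_ge0 => //; apply: addr_ge0 => //; exact: sqr_ge0.
exists (1 + ((1 + K ^+ 2) * m + K)); first exact: addr_ge0.
move=> x tx; have [x1|x1] := leP 1 x.
  have x0 : 0 < x by exact: lt_le_trans x1.
  rewrite ger0_norm ?subr_ge0; last by apply: mills_lower; exact: ltW.
  apply: le_trans (ler_wpDr B0 (lexx 1)).
  have h := mills_upper x0.
  have h1 : mills x <= 1.
    by apply: le_trans h; rewrite ler_peMl ?mills_ge0.
  rewrite mulrDl mul1r expr2 -mulrA -addrA -[leRHS]addr0 lerD//.
  by rewrite subr_le0; apply: ler_piMr => //; exact: ltW.
have xK : `|x| <= K.
  rewrite ler_norml; apply/andP; split; last by rewrite (le_trans (ltW x1)).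
  rewrite lerNl (@le_trans _ _ `|t|) ?le_max ?lexx//.
  by rewrite -normrN (le_trans _ (ler_norm (- t)))// lerN2.
have x2K : x ^+ 2 <= K ^+ 2.
  by rewrite -real_normK ?num_real// lerXn2r// ?nnegrE.
have hm : mills x <= m.
  apply: ler_pM; rewrite ?expR_ge0//.
  - by rewrite mulr_ge0 ?gauss_tail_ge0 ?invr_ge0 ?ltW.
  - by rewrite ler_pM2l ?invr_gt0// gauss_tail_nincr.
  - by rewrite ler_expR ler_pM2r.
apply: le_trans (ler_normB _ _) _.
apply: (le_trans _ (ler_wpDl ler01 (lexx _))); apply: lerD => //.
have p2 (y : R) : 0 <= 1 + y ^+ 2 by rewrite addr_ge0 ?sqr_ge0.
rewrite ger0_norm; last by rewrite mulr_ge0 ?mills_ge0.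
by apply: ler_pM; rewrite ?mills_ge0// lerD2l.
Qed.

Lemma mulx_mills_lipschitz (t : R) : exists2 L, 0 <= L &
  forall x y, t <= x -> x <= y -> `|y * mills y - x * mills x| <= L * (y - x).
Proof.
have [L L0 hL] := mills_derive_bound t; exists L => // x y tx xy.
have dm z : z \in `]x, y[%R ->
    is_derive z 1 (fun u => u * mills u) ((1 + z ^+ 2) * mills z - z).
  move=> _; have h := is_derive_mills z.
  by apply: is_derive_eq; rewrite /GRing.scale /=; ring.
have cG : {within `[x, y], continuous (fun u => u * mills u)}.
  apply: derivable_within_continuous => z _; have h := is_derive_mills z.
  by case: (is_deriveM (is_derive_id z 1) h).
have [z /andP[xz _] E] := MVT_segment xy dm cG.
rewrite E normrM (ger0_norm (_ : 0 <= y - x)) ?subr_ge0//.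
by rewrite ler_wpM2r ?subr_ge0 ?hL// (le_trans tx).
Qed.

End Mills.

(** * Solution of Stein's equation *)

Section Glue.
Variables (R : realType) (t d0 d1 L : R) (fL fR : R -> R).
Hypothesis fLR : fL t = fR t.
Hypothesis dfL : forall x : R, is_derive x 1 fL (x * fL x + d0).
Hypothesis dfR : forall x : R, is_derive x 1 fR (x * fR x + d1).
Hypothesis d01 : d0 <= d1.
Hypothesis lipL : forall x y, x <= y -> y <= t -> `|y * fL y - x * fL x| <= L * (y - x).
Hypothesis lipR : forall x y, t <= x -> x <= y -> `|y * fR y - x * fR x| <= L * (y - x).

Definition glue (x : R) : R := if x <= t then fL x else fR x.

Lemma glueL x : x <= t -> glue x = fL x.
Proof. by rewrite /glue => ->. Qed.

Lemma glueR x : t <= x -> glue x = fR x.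
Proof. by rewrite /glue le_eqVlt => /predU1P[<-|]; rewrite ?lexx// leNgt => ->. Qed.

Lemma glue_lipschitz_le x y : x <= y -> `|y * glue y - x * glue x| <= L * (y - x).
Proof.
move=> xy; have [yt|ty] := leP y t.
  by rewrite !glueL ?lipL// (le_trans xy).
have [xt|tx] := leP t x.
  by rewrite (glueR xt) (glueR (ltW ty)) lipR.
rewrite (glueR (ltW ty)) (glueL (ltW tx)).
have -> : y * fR y - x * fL x = (y * fR y - t * fR t) + (t * fL t - x * fL x).
  by rewrite fLR; ring.
apply: le_trans (ler_normD _ _) _.
have -> : L * (y - x) = L * (y - t) + L * (t - x) by ring.
by apply: lerD; [apply: lipR|apply: lipL] => //; exact: ltW.
Qed.

Lemma glue_lipschitz x y : `|y * glue y - x * glue x| <= L * `|y - x|.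
Proof.
have [xy|/ltW yx] := leP x y.
  by rewrite (ger0_norm (_ : 0 <= y - x)) ?subr_ge0// glue_lipschitz_le.
by rewrite distrC (distrC y) (ger0_norm (_ : 0 <= x - y)) ?subr_ge0// glue_lipschitz_le.
Qed.

Lemma increment_ge (f : R -> R) (d k u v : R) :
  (forall x : R, is_derive x 1 f (x * f x + d)) ->
  (forall x, u <= x <= v -> k <= x * f x) -> u <= v ->
  (v - u) * (k + d) <= f v - f u.
Proof.
move=> df hk uv.
have dm z : z \in `]u, v[%R -> is_derive z 1 f (z * f z + d) by [].
have cf : {within `[u, v], continuous f}.
  by apply: derivable_within_continuous => z _; case: (df z).
have [z + ->] := MVT_segment uv dm cf.
by rewrite in_itv /= => zuv; rewrite mulrC ler_wpM2r ?subr_ge0// lerD2r hk.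
Qed.

Lemma glue_increment_right k u v : t <= u -> u <= v ->
  (forall x, u <= x <= v -> k <= x * glue x) ->
  (v - u) * (k + d1) <= glue v - glue u.
Proof.
move=> tu uv hk; rewrite !glueR ?(le_trans tu)//; apply: increment_ge => // x xuv.
by rewrite -glueR ?hk// (le_trans tu)//; case/andP: xuv.
Qed.

(** As [d0 <= d1], the smaller constant is valid on both sides of t; an interval containing t is cut
    there and the two mean-value bounds are added. *)
Lemma glue_increment k u v : u <= v ->
  (forall x, u <= x <= v -> k <= x * glue x) ->
  (v - u) * (k + d0) <= glue v - glue u.
Proof.
have hl w z : w <= z -> z <= t -> (forall x, w <= x <= z -> k <= x * glue x) ->
    (z - w) * (k + d0) <= glue z - glue w.
  move=> wz zt hk; rewrite !glueL ?(le_trans wz)//; apply: increment_ge => // x xwz.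
  by rewrite -glueL ?hk// (le_trans _ zt)//; case/andP: xwz.
have hr w z : t <= w -> w <= z -> (forall x, w <= x <= z -> k <= x * glue x) ->
    (z - w) * (k + d0) <= glue z - glue w.
  move=> tw wz hk; apply: le_trans (glue_increment_right tw wz hk).
  by rewrite ler_wpM2l ?subr_ge0// lerD2l.
move=> uv hk; have [vt|/ltW tv] := leP v t; first exact: hl.
have [tu|/ltW ut] := leP t u; first exact: hr.
have -> : glue v - glue u = (glue v - glue t) + (glue t - glue u) by ring.
have -> : (v - u) * (k + d0) = (v - t) * (k + d0) + (t - u) * (k + d0) by ring.
apply: lerD.
  by apply: hr => // x /andP[tx xv]; apply: hk; rewrite xv (le_trans ut).
by apply: hl => // x /andP[ux xt]; apply: hk; rewrite ux (le_trans xt).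
Qed.

Lemma near_glue_ge (w y x : R) : 0 <= L -> `|x - w| <= `|y| ->
  w * glue w - L * `|y| <= x * glue x.
Proof.
move=> L0 xwy; rewrite lerBlDr -lerBlDl.
apply: le_trans (ler_norm _) _; rewrite distrC.
by rewrite (le_trans (glue_lipschitz _ _))// ler_wpM2l.
Qed.

(** Lower half of a second-order expansion of f at w, multiplied by y so that both signs of y give
    the same inequality. The increment bound is a hypothesis with a free constant d, to serve both
    for [d0] everywhere and for [d1] to the right of t. *)
Lemma glue_taylor (d w y : R) : 0 <= L ->
  (forall u v k, Num.min w (w + y) <= u -> u <= v ->
    (forall x, u <= x <= v -> k <= x * glue x) ->
    (v - u) * (k + d) <= glue v - glue u) ->
  y ^+ 2 * (w * glue w + d - L * `|y|) <= y * (glue (w + y) - glue w).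
Proof.
move=> L0 h; have [y0|/ltW y0] := leP 0 y.
  rewrite expr2 -mulrA ler_wpM2l//.
  have := h w (w + y) (w * glue w - L * `|y|).
  rewrite ge_min lexx lerDl y0 => /(_ isT isT).
  have -> : w + y - w = y by ring.
  rewrite addrAC; apply=> x /andP[wx xy]; apply: near_glue_ge => //.
  by rewrite !ger0_norm ?subr_ge0// lerBlDl.
have -> : y * (glue (w + y) - glue w) = - y * (glue w - glue (w + y)) by ring.
rewrite -sqrrN expr2 -mulrA ler_wpM2l ?oppr_ge0//.
have := h (w + y) w (w * glue w - L * `|y|).
rewrite ge_min lexx orbT gerDl y0 => /(_ isT isT).
have -> : w - (w + y) = - y by ring.
rewrite addrAC; apply=> x /andP[yx xw]; apply: near_glue_ge => //.
rewrite distrC (ger0_norm (_ : 0 <= w - x)) ?subr_ge0// ler0_norm//.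
by rewrite lerBlDr -lerBlDl opprK.
Qed.

End Glue.

Section Stein.
Variables (R : realType) (c : R) (G : R -> R).
Hypothesis c_gt0 : 0 < c.
Hypothesis derG : forall x : R, is_derive x 1 G (- (c * expR (- (x ^+ 2 / 2)))).
Hypothesis cvgG : G x @[x --> +oo] --> (0 : R).
Hypothesis cvgG1 : G x @[x --> -oo] --> (1 : R).

(** The reflected tail satisfies the same hypotheses as [G], so the Mills estimates on right
    half-lines also cover the left branch, without an appeal to the symmetry of the Gaussian. *)
Let H (x : R) : R := 1 - G (- x).

Let derH (x : R) : is_derive x 1 H (- (c * expR (- (x ^+ 2 / 2)))).
Proof.
have hN : is_derive x 1 (fun y : R => - y) (- 1).
  by apply: is_derive_eq.
have hG := derG (- x).
have hc : is_derive x 1 (fun y => G (- y)) _ := @is_derive1_comp _ G _ x _ _ hG hN.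
apply: is_derive_eq; rewrite sqrrN; ring.
Qed.

Let cvgH : H x @[x --> +oo] --> (0 : R).
Proof.
rewrite -(subrr 1); apply: cvgB; first exact: cvg_cst.
by apply: cvg_comp cvgG1; apply/cvgNrNy; exact: cvg_id.
Qed.

(* Solution of Stein's equation f' x - x f x = [t < x] - G t. *)
Definition stein_left (t x : R) : R := - G t * mills c H (- x).
Definition stein_right (t x : R) : R := - (1 - G t) * mills c G x.
Definition stein (t : R) : R -> R := glue t (stein_left t) (stein_right t).

Lemma is_derive_stein_left (t x : R) :
  is_derive x 1 (stein_left t) (x * stein_left t x + - G t).
Proof.
have hN : is_derive x 1 (fun y : R => - y) (- 1) by apply: is_derive_eq.
have hM := is_derive_mills c_gt0 derH (- x).
have hc : is_derive x 1 (fun y => mills c H (- y)) _ := is_derive1_comp hM hN.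
by apply: is_derive_eq; rewrite /stein_left /GRing.scale /=; ring.
Qed.

Lemma is_derive_stein_right (t x : R) :
  is_derive x 1 (stein_right t) (x * stein_right t x + (1 - G t)).
Proof.
have hM := is_derive_mills c_gt0 derG x.
by apply: is_derive_eq; rewrite /stein_right /GRing.scale /=; ring.
Qed.

Lemma stein_taylor (t : R) : exists2 L, 0 <= L &
  [/\ forall x y, `|y * stein t y - x * stein t x| <= L * `|y - x|,
   forall w y, y ^+ 2 * (w * stein t w + - G t - L * `|y|)
      <= y * (stein t (w + y) - stein t w) &
   forall w y r, t + r <= w -> `|y| <= r ->
      y ^+ 2 * (w * stein t w + (1 - G t) - L * `|y|)
      <= y * (stein t (w + y) - stein t w)].
Proof.
have [L1 L10 h1] := mulx_mills_lipschitz c_gt0 derH cvgH (- t).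
have [L2 L20 h2] := mulx_mills_lipschitz c_gt0 derG cvgG t.
pose L := `|G t| * L1 + `|1 - G t| * L2.
have L0 : 0 <= L by rewrite addr_ge0 ?mulr_ge0.
have lipL x y : x <= y -> y <= t ->
    `|y * stein_left t y - x * stein_left t x| <= L * (y - x).
  move=> xy yt; rewrite /stein_left.
  have -> : y * (- G t * mills c H (- y)) - x * (- G t * mills c H (- x)) =
      - (G t * (- x * mills c H (- x) - - y * mills c H (- y))) by ring.
  rewrite normrN normrM mulrDl ler_wpDr ?mulr_ge0 ?subr_ge0//.
  rewrite -mulrA ler_wpM2l//.
  have := @h1 (- y) (- x); rewrite !lerN2 => /(_ yt xy).
  by have -> : - x - - y = y - x by ring.
have lipR x y : t <= x -> x <= y ->
    `|y * stein_right t y - x * stein_right t x| <= L * (y - x).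
  move=> tx xy; rewrite /stein_right.
  have -> : y * (- (1 - G t) * mills c G y) - x * (- (1 - G t) * mills c G x) =
      - ((1 - G t) * (y * mills c G y - x * mills c G x)) by ring.
  rewrite normrN normrM mulrDl ler_wpDl ?mulr_ge0 ?subr_ge0//.
  by rewrite -mulrA ler_wpM2l// h2.
(* The branches meet because H (- t) = 1 - G t. *)
have tE : stein_left t t = stein_right t t.
  by rewrite /stein_left /stein_right /mills /H opprK sqrrN; ring.
have dd : - G t <= 1 - G t by rewrite lerDr.
exists L => //; split.
- exact: glue_lipschitz.
- move=> w y; apply: glue_taylor => // u v k _.
  apply: (glue_increment tE _ _ dd) => //; first exact: is_derive_stein_left.
  exact: is_derive_stein_right.
- move=> w y r trw yr; apply: glue_taylor => // u v k wu.
  apply: (glue_increment_right tE (is_derive_stein_right t)).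
  apply: le_trans wu; rewrite le_min.
  have r0 : 0 <= r by exact: le_trans yr.
  apply/andP; split; first by rewrite (le_trans _ trw)// lerDl.
  rewrite -[t](addrK r) lerD// lerNl (le_trans _ yr)//.
  by rewrite -normrN ler_norm.
Qed.

End Stein.

(** * Expectations under product distributions *)

Section Walk.
Variables (R : realType) (X : finType).
Implicit Types (P g : X -> R) (phi psi : R -> R).

(* [walk P g n phi s] is the expectation of phi (s + g x_1 + ... + g x_n) when
   the x_i are drawn independently from P. *)
Definition step P g phi (s : R) : R := \sum_a P a * phi (g a + s).
Definition walk P g n phi : R -> R := iter n (step P g) phi.

Lemma walkS P g n phi : walk P g n.+1 phi = walk P g n (step P g phi).
Proof. exact: iterSr. Qed.

Lemma sum_tupleS (n : nat) (F : n.+1.-tuple X -> R) :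
  \sum_(x : n.+1.-tuple X) F x = \sum_a \sum_(x : n.-tuple X) F [tuple of a :: x].
Proof.
rewrite pair_big /=.
rewrite (reindex (fun p : X * n.-tuple X => [tuple of p.1 :: p.2])) //=.
exists (fun x : n.+1.-tuple X => (thead x, [tuple of behead x])) => [[a x] _|x _] /=.
  by rewrite theadE; congr (_, _); exact: val_inj.
by rewrite [RHS]tuple_eta; exact: val_inj.
Qed.

Lemma prodPS P (n : nat) a (x : n.-tuple X) :
  prodP P [tuple of a :: x] = P a * prodP P x.
Proof.
rewrite /prodP big_ord_recl tnth0; congr (_ * _).
by apply: eq_bigr => i _; rewrite tnthS.
Qed.

Lemma sum_prodP_walk P g n phi s :
  \sum_(x : n.-tuple X) prodP P x * phi (s + \sum_(a <- x) g a) = walk P g n phi s.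
Proof.
elim: n s => [|n IH] s.
  rewrite (big_pred1 [tuple]) => [|x]; last by rewrite [x]tuple0.
  by rewrite /prodP big_ord0 mul1r big_nil addr0.
rewrite sum_tupleS /walk iterS /step; apply: eq_bigr => a _.
rewrite -/(walk P g n phi) -IH mulr_sumr; apply: eq_bigr => x _.
by rewrite prodPS big_cons -mulrA addrCA addrA.
Qed.

Lemma sum_prodP_cond P g n (A : pred R) :
  \sum_(x : n.-tuple X | A (\sum_(a <- x) g a)) prodP P x =
  walk P g n (fun s => (A s)%:R) 0.
Proof.
rewrite -sum_prodP_walk big_mkcond; apply: eq_bigr => x _.
by rewrite add0r; case: (A _); rewrite ?mulr1 ?mulr0.
Qed.

Section Dist.
Variables (P g : X -> R).
Hypothesis P_ge0 : forall a, 0 <= P a.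
Hypothesis P_sum1 : \sum_a P a = 1.

Lemma step_le phi psi : (forall s, phi s <= psi s) ->
  forall s, step P g phi s <= step P g psi s.
Proof. by move=> h s; apply: ler_sum => a _; exact: ler_wpM2l. Qed.

Lemma walk_le n phi psi : (forall s, phi s <= psi s) ->
  forall s, walk P g n phi s <= walk P g n psi s.
Proof. by move=> h; elim: n => [|n IH] //=; exact: step_le. Qed.

Lemma walkD n phi psi s :
  walk P g n (fun u => phi u + psi u) s = walk P g n phi s + walk P g n psi s.
Proof.
elim: n s => [|n IH] s //=; rewrite /step -big_split; apply: eq_bigr => a _ /=.
by rewrite IH mulrDr.
Qed.

Lemma walkZ n k phi s : walk P g n (fun u => k * phi u) s = k * walk P g n phi s.
Proof.
elim: n s => [|n IH] s //=; rewrite /step mulr_sumr; apply: eq_bigr => a _ /=.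
by rewrite IH mulrCA.
Qed.

Lemma walk_cst n k s : walk P g n (fun=> k) s = k.
Proof.
elim: n s => [|n IH] s //=; rewrite /step.
under eq_bigr do rewrite IH.
by rewrite -mulr_suml P_sum1 mul1r.
Qed.

Definition wstep phi (s : R) : R := \sum_a P a * (g a * phi (g a + s)).

Lemma step_wstep phi : step P g (wstep phi) = wstep (step P g phi).
Proof.
apply/funext => s; rewrite /step /wstep.
under eq_bigr do rewrite mulr_sumr.
rewrite exchange_big; apply: eq_bigr => a _; rewrite !mulr_sumr.
apply: eq_bigr => b _; rewrite addrCA; ring.
Qed.

(** By exchangeability the n summands contribute equally; [step_wstep] is what moves the weighted
    letter past the others. The truncated [n.-1] at n = 0 is harmless thanks to the factor n. *)
Lemma walk_mulx n phi s :
  walk P g n (fun u => u * phi u) s =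
  s * walk P g n phi s + n%:R * walk P g n.-1 (wstep phi) s.
Proof.
elim: n phi s => [|n IH] phi s; first by rewrite mul0r addr0.
rewrite !walkS.
have -> : step P g (fun u => u * phi u) =
    (fun u => wstep phi u + u * step P g phi u).
  apply/funext => u; rewrite /step /wstep mulr_sumr -big_split /=.
  by apply: eq_bigr => a _; ring.
rewrite walkD IH -step_wstep; case: n {IH} => [|n].
  by rewrite /walk /= mul0r mul1r addr0 addrC.
by rewrite !succnK -!walkS -(natr1 n.+1); ring.
Qed.

End Dist.
End Walk.

(** * The Gaussian tail function *)

Section Gauss.
Variable R : realType.
Notation mu := (@lebesgue_measure R).
Notation pdf := (@normal_pdf R 0 1).
Local Notation gaussQ := (@gaussQ R).

Lemma normal_pdf01E (x : R) : pdf x = normal_peak 1 * expR (- (x ^+ 2 / 2)).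
Proof.
rewrite normal_pdfE ?oner_neq0// /normal_fun subr0 expr1n mulNr.
by rewrite -[1 *+ 2]/(2%:R).
Qed.

Lemma gaussQE (x : R) : gaussQ x = 1 - (\int[mu]_(t in `]-oo, x]) pdf t)%R.
Proof.
rewrite /gaussQ /Defs.gaussQ.
have -> : [set u : R | x < u] = ~` `]-oo, x].
  by rewrite -set_itvoy -setCitvl.
rewrite (@probability_setC _ _ _ (normal_prob 0 1))//=.
by rewrite fineB ?fin_num_measure.
Qed.

Lemma is_derive_gaussQ (x : R) :
  is_derive x 1 gaussQ (- (normal_peak 1 * expR (- (x ^+ 2 / 2)))).
Proof.
have pc : continuous pdf by apply: continuous_normal_pdf; exact: oner_neq0.
have [dF F'] : derivable (fun y : R => \int[mu]_(t in `]-oo, y]) pdf t)%R x 1 /\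
    (fun y : R => \int[mu]_(t in `]-oo, y]) pdf t)%R^`() x = pdf x.
  apply: (@continuous_FTC1 R pdf -oo%O x (x + 1)) => //.
  - by rewrite ltrDl.
  - by apply: integrableS (integrable_normal_pdf 0 1).
  - exact: ltNyr.
  - exact: pc.
have hF : is_derive x 1 (fun y : R => \int[mu]_(t in `]-oo, y]) pdf t)%R
    (normal_peak 1 * expR (- (x ^+ 2 / 2))).
  by split => //; rewrite -derive1E F' normal_pdf01E.
rewrite (_ : gaussQ = (fun y => 1 - \int[mu]_(t in `]-oo, y]) pdf t)%R).
  by apply: is_derive_eq; rewrite add0r mul1r.
by apply/funext => y; exact: gaussQE.
Qed.

(** The identity as a random variable makes [gaussQ] a complementary distribution function, whose
    limits at both infinities are known. *)
Let idTR : measurableTypeR R -> R := idfun.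

#[local] HB.instance Definition _ :=
  @isMeasurableFun.Build _ _ _ _ idTR (@measurable_id _ _ setT).

Let gaussQ_ccdf (x : R) :
  gaussQ x = fine (ccdf (idTR : {RV (normal_prob 0 1) >-> R}) x).
Proof.
rewrite /ccdf /distribution /pushforward /gaussQ /Defs.gaussQ; congr (fine (normal_prob 0 1 _)).
by apply/seteqP; split => u; rewrite /= /idTR in_itv /= andbT.
Qed.

Lemma cvg_gaussQ_pinfty : gaussQ x @[x --> +oo] --> (0 : R).
Proof. by under eq_fun do rewrite gaussQ_ccdf; exact/fine_cvg/cvg_ccdfy0. Qed.

Lemma cvg_gaussQ_ninfty : gaussQ x @[x --> -oo] --> (1 : R).
Proof. by under eq_fun do rewrite gaussQ_ccdf; exact/fine_cvg/cvg_ccdfNy1. Qed.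

Lemma continuous_gaussQ : continuous gaussQ.
Proof.
by move=> x; apply/differentiable_continuous/derivable1_diffP; case: (is_derive_gaussQ x).
Qed.

(** [gaussQinv] chooses a preimage, with default 0, so only existence is at stake: the intermediate
    value theorem gives it from the two limits. *)
Lemma gaussQ_gaussQinv (eps : R) : 0 < eps < 1 -> gaussQ (gaussQinv eps) = eps.
Proof.
move=> /andP[e0 e1]; rewrite /gaussQinv.
suff [t ht] : exists t, gaussQ t = eps.
  by have := @xgetPex _ 0 [set t | gaussQ t = eps] (ex_intro _ t ht).
have [b [b0 hb]] : exists b, 0 <= b /\ gaussQ b < eps.
  have := @cvgr_lt _ _ _ _ gaussQ 0 cvg_gaussQ_pinfty eps e0.
  move=> h; near (pinfty_nbhs R) => b; exists b; split; last by near: b; exact: h.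
  by near: b; apply: nbhs_pinfty_ge; rewrite num_real.
have [a [a0 ha]] : exists a, a <= 0 /\ eps < gaussQ a.
  have := @cvgr_gt _ _ _ _ gaussQ 1 cvg_gaussQ_ninfty eps e1.
  move=> h; near (ninfty_nbhs R) => a; exists a; split; last by near: a; exact: h.
  by near: a; apply: nbhs_ninfty_le; rewrite num_real.
have ab : a <= b by exact: le_trans b0.
have [|t _ tE] := @IVT R gaussQ a b eps ab (continuous_subspaceT continuous_gaussQ).
  by rewrite ge_min le_max (ltW ha) (ltW hb) orbT.
by exists t.
Unshelve. all: by end_near. Qed.

End Gauss.

(** * Central limit theorem *)

Section SteinWalk.
Variables (R : realType) (X : finType) (P y : X -> R) (n : nat) (r : R).
Hypothesis P_ge0 : forall a, 0 <= P a.
Hypothesis P_sum1 : \sum_a P a = 1.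
Hypothesis y_mean : \sum_a P a * y a = 0.
Hypothesis y_var : \sum_a P a * y a ^+ 2 = n.+1%:R^-1.
Hypothesis y_bound : forall a, `|y a| <= r.

(* Stein's identity E[W f(W)] = (n+1) E[y(x_1) (f(W) - f(W - y(x_1)))]; since
   the solution f has a kink at t, the event t <= W is only controlled on
   t + r <= W, which costs one step size r. *)
Lemma walk_tail_le (t L : R) (G : R) (f : R -> R) : 0 <= L ->
  (forall x z, `|z * f z - x * f x| <= L * `|z - x|) ->
  (forall w z, z ^+ 2 * (w * f w + - G - L * `|z|) <= z * (f (w + z) - f w)) ->
  (forall w z, t + r <= w -> `|z| <= r ->
     z ^+ 2 * (w * f w + (1 - G) - L * `|z|) <= z * (f (w + z) - f w)) ->
  walk P y n.+1 (fun w => (t + 2 * r <= w)%R%:R) 0 <= G + 2 * L * r.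
Proof.
move=> L0 lip tay1 tay2.
pose I (w : R) : R := (t + r <= w)%R%:R.
pose k (w : R) := w * f w.
have n0 : 0 < n.+1%:R :> R by rewrite ltr0n.
have tay w a : y a ^+ 2 * (k w + I w - G - L * r) <= y a * (f (w + y a) - f w).
  have h : L * `|y a| <= L * r by rewrite ler_wpM2l.
  rewrite /I; case: (boolP (t + r <= w)) => [tw|_] /=.
    apply: le_trans (tay2 _ _ tw (y_bound a)); rewrite ler_wpM2l ?sqr_ge0//.
    by rewrite mulr1n /k; lra.
  apply: le_trans (tay1 w (y a)); rewrite ler_wpM2l ?sqr_ge0//.
  by rewrite mulr0n /k; lra.
(* As y has mean 0, [f w] may be subtracted inside the average; the weights P y^2 then sum to 1 /
   (n+1), which cancels the factor n+1 of [walk_mulx] in [E1]. *)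
have B w : n.+1%:R^-1 * (k w + I w - G - L * r) <= wstep P y f w.
  have -> : wstep P y f w = \sum_a P a * (y a * (f (w + y a) - f w)).
    have e : \sum_a P a * y a * f w = 0 by rewrite -mulr_suml y_mean mul0r.
    rewrite /wstep -[LHS]subr0 -[X in _ - X]e -sumrB.
    by apply: eq_bigr => a _; rewrite (addrC w); ring.
  rewrite -y_var mulr_suml; apply: ler_sum => a _.
  by rewrite -mulrA ler_wpM2l.
have E1 : walk P y n k 0 + walk P y n I 0 - G - L * r <= walk P y n.+1 k 0.
  rewrite [leRHS]walk_mulx mul0r add0r succnK.
  have := walk_le y P_ge0 n B 0.
  rewrite walkZ => h; rewrite -(ler_pM2l (_ : 0 < n.+1%:R^-1)) ?invr_gt0//.
  rewrite mulKf ?gt_eqF//; apply: le_trans h; rewrite ler_pM2l ?invr_gt0//.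
  have -> : (fun u => k u + I u - G - L * r) = (fun u => k u + (I u + (- G - L * r))).
    by apply/funext => u; ring.
  by rewrite !walkD !walk_cst// !addrA.
(* Dropping the last step changes the mean of W f W by at most L r, so this mean cancels between
   [E1] and [E2] and two errors L r remain. *)
have E2 : walk P y n.+1 k 0 <= walk P y n k 0 + L * r.
  rewrite walkS -[X in _ + X](walk_cst y P_sum1 n (L * r) 0) -walkD.
  apply: walk_le => // w; rewrite /step.
  rewrite -[leRHS]mul1r -P_sum1 mulr_suml; apply: ler_sum => a _.
  rewrite ler_wpM2l// -lerBlDl (le_trans (ler_norm _))//.
  by rewrite (le_trans (lip _ _))// addrK ler_wpM2l.
have E3 : walk P y n.+1 (fun w => (t + 2 * r <= w)%R%:R) 0 <= walk P y n I 0.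
  rewrite walkS; apply: walk_le => // w; rewrite /step /I.
  have [tw|tw] := leP (t + r) w.
    rewrite -[leRHS]P_sum1; apply: ler_sum => a _.
    by rewrite ler_piMr// lern1 leq_b1.
  rewrite big1// => a _; rewrite leNgt.
  rewrite (_ : y a + w < t + 2 * r) ?mulr0//.
  have -> : t + 2 * r = r + (t + r) by ring.
  by rewrite ler_ltD// (le_trans (ler_norm _)).
lra.
Qed.

End SteinWalk.

Lemma near_mul_sqrt_lt (R : realType) (V k d : R) : 0 <= V -> 0 < d ->
  \forall n \near \oo, k * Num.sqrt (V / n%:R) < d.
Proof.
move=> V0 d0; near=> n.
have n0 : 0 < n%:R :> R by rewrite ltr0n; near: n; exact: nbhs_infty_gt.
have hn : k ^+ 2 * V / d ^+ 2 < n%:R by near: n; exact: nbhs_infty_gtr.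
rewrite ltNge; apply/negP => h.
have : d ^+ 2 <= (k * Num.sqrt (V / n%:R)) ^+ 2.
  rewrite lerXn2r// nnegrE; first exact: ltW.
  exact/ltW/(lt_le_trans d0 h).
rewrite exprMn sqr_sqrtr; last by rewrite divr_ge0// ltW.
rewrite leNgt mulrA ltr_pdivrMr//.
by rewrite (mulrC (d ^+ 2)) -ltr_pdivrMr ?exprn_gt0// hn.
Unshelve. all: by end_near. Qed.

Section CLT.
Variables (R : realType) (X : finType) (P g : X -> R).
Hypothesis P_ge0 : forall a, 0 <= P a.
Hypothesis P_sum1 : \sum_a P a = 1.
Let m := \sum_a P a * g a.
Let V := \sum_a P a * (g a - m) ^+ 2.
Hypothesis V_gt0 : 0 < V.

Lemma clt_upper (tau e : R) : 0 < e -> \forall n \near \oo,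
  \sum_(x : n.-tuple X | m + Num.sqrt (V / n%:R) * tau <= (\sum_(a <- x) g a) / n%:R)
    prodP P x <= gaussQ tau + e.
Proof.
move=> e0.
(* [t] is fixed before n, so L does not depend on n; the gap tau - t will absorb the shift 2 r of
   [walk_tail_le]. *)
have [t [tt ht]] : exists t, t < tau /\ gaussQ t < gaussQ tau + e / 2.
  have : gaussQ x @[x --> tau^'-] --> gaussQ tau.
    by apply: cvg_at_left_filter; exact: continuous_gaussQ.
  have e2 : gaussQ tau < gaussQ tau + e / 2 by rewrite ltrDl divr_gt0.
  move=> /cvgr_lt/(_ _ e2) h; near tau^'- => t; exists t; split.
    by near: t; exact: nbhs_left_lt.
  by near: t; exact: h.
have [L L0 [lip tay1 tay2]] := @stein_taylor R _ _ (normal_peak_gt0 (oner_neq0 R))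
  (@is_derive_gaussQ R) (@cvg_gaussQ_pinfty R) (@cvg_gaussQ_ninfty R) t.
pose b : R := \sum_a `|g a - m|.
have b0 : 0 <= b by apply: sumr_ge0 => a _; exact: normr_ge0.
have gb a : `|g a - m| <= b by rewrite /b (bigD1 a)//= lerDl sumr_ge0.
pose rr (n : nat) : R := b / V * Num.sqrt (V / n%:R).
have main n : t + 2 * rr n.+1 <= tau ->
    \sum_(x : n.+1.-tuple X | m + Num.sqrt (V / n.+1%:R) * tau
       <= (\sum_(a <- x) g a) / n.+1%:R) prodP P x <= gaussQ t + 2 * L * rr n.+1.
  move=> rt.
  have nR : 0 < n.+1%:R :> R by rewrite ltr0n.
  pose sg : R := Num.sqrt (V / n.+1%:R).
  have sg0 : 0 <= sg by exact: sqrtr_ge0.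
  have sg2 : sg ^+ 2 = V / n.+1%:R by rewrite sqr_sqrtr// divr_ge0// ltW.
  have VN0 : V != 0 by exact: lt0r_neq0.
  (* [sg / V] is 1 / sqrt (V (n+1)), written without a root in a denominator. *)
  pose y a := (g a - m) / V * sg.
  have ym : \sum_a P a * y a = 0.
    under eq_bigr do rewrite /y !mulrA mulrBr.
    by rewrite -!mulr_suml sumrB -mulr_suml P_sum1 mul1r subrr !mul0r.
  have yv : \sum_a P a * y a ^+ 2 = n.+1%:R^-1.
    have -> : \sum_a P a * y a ^+ 2 = V * (V^-1 ^+ 2 * (V / n.+1%:R)).
      rewrite [RHS]mulr_suml; apply: eq_bigr => a _.
      by rewrite /y !exprMn sg2; ring.
    by field; rewrite VN0 lt0r_neq0.
  have yb a : `|y a| <= rr n.+1.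
    rewrite /y !normrM (ger0_norm sg0) ler_wpM2r// normfV (gtr0_norm V_gt0).
    by rewrite ler_pM2r ?invr_gt0.
  have key := @walk_tail_le R X P y n (rr n.+1) P_ge0 P_sum1 ym yv yb t L (gaussQ t) _
    L0 lip tay1 (fun w z => tay2 w z _).
  apply: le_trans (_ : walk P y n.+1 (fun w => (t + 2 * rr n.+1 <= w)%R%:R) 0 <= _).
    rewrite -(@sum_prodP_cond _ _ P y n.+1 (fun w => t + 2 * rr n.+1 <= w)).
    rewrite big_mkcond [leRHS]big_mkcond /=; apply: ler_sum => x _.
    have px : 0 <= prodP P x by exact: prodr_ge0.
    case: ifPn => [h|_]; last by case: ifP.
    rewrite ifT//.
    have sE : \sum_(a <- x) y a = (\sum_(a <- x) g a - n.+1%:R * m) / V * sg.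
      rewrite -!mulr_suml sumrB; congr ((_ - _) / _ * _).
      by rewrite big_const_seq count_predT size_tuple iter_addr_0 mulr_natl.
    apply: (@le_trans _ _ tau) => //.
    rewrite ler_pdivlMr// in h.
    have -> : tau = (n.+1%:R * sg * tau) / V * sg.
      have -> : n.+1%:R * sg * tau / V * sg = n.+1%:R * tau / V * sg ^+ 2 by ring.
      by rewrite sg2; field; rewrite VN0 lt0r_neq0.
    rewrite sE ler_wpM2r// ler_pM2r ?invr_gt0//.
    by move: h; rewrite -/sg; lra.
  exact: key.
(* The first bound gives t + 2 r <= tau, the second 2 L r <= e / 2; L + 1 keeps the denominator
   positive. *)
have d0 : 0 < Num.min ((tau - t) / 2) (e / (4 * (L + 1))).
  by rewrite lt_min !divr_gt0 ?subr_gt0// mulr_gt0// ltr_wpDl.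
near=> n.
have n0 : (0 < n)%N by near: n; exact: nbhs_infty_gt.
have : rr n < Num.min ((tau - t) / 2) (e / (4 * (L + 1))).
  by near: n; exact: near_mul_sqrt_lt (ltW V_gt0) d0.
rewrite lt_min => /andP[r1 r2].
apply: le_trans (_ : gaussQ t + 2 * L * rr n <= _).
  have := main n.-1; rewrite prednK//; apply; lra.
have : rr n * (4 * (L + 1)) < e by rewrite -ltr_pdivlMr// mulr_gt0// ltr_wpDl.
have : 0 <= rr n by rewrite mulr_ge0// divr_ge0// ltW.
move: ht; set q := gaussQ _; set q' := gaussQ _; nra.
Unshelve. all: by end_near. Qed.

End CLT.

(** * Tail bounds for empirical means *)

Section WeakLaw.
Variables (R : realType) (X : finType) (P g : X -> R).
Hypothesis P_ge0 : forall a, 0 <= P a.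
Hypothesis P_sum1 : \sum_a P a = 1.
Let m := \sum_a P a * g a.
Let v := \sum_a P a * (g a - m) ^+ 2.

Lemma prodP_ge0 n (x : n.-tuple X) : 0 <= prodP P x.
Proof. exact: prodr_ge0. Qed.

Lemma sum_prodP1 n : \sum_(x : n.-tuple X) prodP P x = 1.
Proof.
rewrite -(walk_cst P P_sum1 n 1 0) -sum_prodP_walk.
by apply: eq_bigr => x _; rewrite mulr1.
Qed.

Lemma chebyshev_upper n (d : R) : (0 < n)%N -> 0 < d ->
  \sum_(x : n.-tuple X | m + d <= (\sum_(a <- x) g a) / n%:R) prodP P x
  <= v / d ^+ 2 / n%:R.
Proof.
move=> n0 d0; have nR : 0 < n%:R :> R by rewrite ltr0n.
pose y a := g a - m.
have ym : \sum_a P a * y a = 0.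
  under eq_bigr do rewrite /y mulrBr.
  by rewrite sumrB -mulr_suml P_sum1 mul1r subrr.
(* Second moment of the centred sum: in [walk_mulx] with phi = id the cross terms vanish because y
   has mean 0. *)
have W : walk P y n (fun u => u * u) 0 = n%:R * v.
  rewrite (walk_mulx P y n id) mul0r add0r.
  rewrite (_ : wstep P y id = fun=> v) ?walk_cst//.
  apply/funext => s; rewrite /wstep.
  have e : \sum_a P a * y a * s = 0 by rewrite -mulr_suml ym mul0r.
  rewrite -[RHS]addr0 -[X in _ = _ + X]e -big_split /=.
  by apply: eq_bigr => a _; rewrite /y; ring.
have -> : v / d ^+ 2 / n%:R = (n%:R * d) ^- 2 * walk P y n (fun u => u * u) 0.
  by rewrite W; field; rewrite !lt0r_neq0.
rewrite -sum_prodP_walk mulr_sumr big_mkcond /=; apply: ler_sum => x _.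
have px := prodP_ge0 x; set S := 0 + _.
have q0 : 0 <= (n%:R * d) ^- 2 by rewrite invr_ge0 sqr_ge0.
case: ifP => [h|_]; last by rewrite mulr_ge0// mulr_ge0// -expr2 sqr_ge0.
rewrite mulrCA ler_peMr// mulrC ler_pdivlMr ?exprn_gt0 ?mulr_gt0// mul1r -expr2.
have Sd : n%:R * d <= S.
  rewrite /S add0r sumrB big_const_seq count_predT size_tuple iter_addr_0.
  by rewrite -mulr_natl; move: h; rewrite ler_pdivlMr//; lra.
by rewrite lerXn2r// nnegrE ?(le_trans _ Sd)// mulr_ge0// ltW.
Qed.

Lemma weak_law (d e : R) : 0 < d -> 0 < e -> \forall n \near \oo,
  \sum_(x : n.-tuple X | m + d <= (\sum_(a <- x) g a) / n%:R) prodP P x <= e.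
Proof.
move=> d0 e0; near=> n.
have n0 : (0 < n)%N by near: n; exact: nbhs_infty_gt.
have hn : v / d ^+ 2 / e < n%:R by near: n; exact: nbhs_infty_gtr.
apply: le_trans (chebyshev_upper n0 d0) _.
by rewrite ler_pdivrMr ?ltr0n// (mulrC e) -ler_pdivrMr// ltW.
Unshelve. all: by end_near. Qed.

Lemma chernoff_lower n (l c : R) : (0 < n)%N -> 0 <= l ->
  \sum_(x : n.-tuple X | (\sum_(a <- x) g a) / n%:R < c) prodP P x
  <= expR (n%:R * (l * c)) * (\sum_a P a * expR (- (l * g a))) ^+ n.
Proof.
move=> n0 l0; have nR : 0 < n%:R :> R by rewrite ltr0n.
set Z := \sum_a _.
(* Exponentials are eigenfunctions of [step], with eigenvalue [Z]. *)
have W k : walk P g k (fun u => expR (- (l * u))) =1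
    (fun s => Z ^+ k * expR (- (l * s))).
  elim: k => [|k IH] s; first by rewrite mul1r.
  rewrite /walk iterS -/(walk P g k _) /step.
  under eq_bigr do rewrite IH mulrDr opprD expRD.
  rewrite exprS -mulrA /Z mulr_suml; apply: eq_bigr => a _; ring.
have := W n 0; rewrite mulr0 oppr0 expR0 mulr1 => <-.
rewrite -sum_prodP_walk mulr_sumr big_mkcond /=; apply: ler_sum => x _.
have px := prodP_ge0 x.
case: ifP => [h|_]; last by rewrite !mulr_ge0 ?expR_ge0.
rewrite add0r mulrCA ler_peMr// -expRD -[X in X <= _]expR0 ler_expR.
rewrite ltr_pdivrMr// in h.
by rewrite subr_ge0 mulrCA ler_wpM2l// mulrC ltW.
Qed.

End WeakLaw.

(** * Lower bounds on tail probabilities by change of measure *)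

Section ChangeOfMeasure.
Variables (R : realType) (X : finType) (P Q g : X -> R).
Hypothesis P_gt0 : forall a, 0 < P a.
Hypothesis Q_gt0 : forall a, 0 < Q a.
Hypothesis Q_sum1 : \sum_a Q a = 1.

Lemma prodP_density n (x : n.-tuple X) :
  prodP P x = prodP Q x * expR (- \sum_(a <- x) ln (Q a / P a)).
Proof.
rewrite /prodP -sumrN expR_sum big_tuple -big_split; apply: eq_bigr => i _ /=.
rewrite expRN lnK ?posrE ?divr_gt0//.
by field; rewrite !lt0r_neq0.
Qed.

(** Under Q, the event and a log-likelihood ratio below n (KL + d/2) hold jointly with probability
    at least 1 - 1/4 - 1/4. There the density of P relative to Q is at least exp (- n (KL + d/2));
    the other d/2 absorbs the factor 1/2 once n d/2 > 1. *)
Lemma lower_tail_ge (c d : R) : \sum_a Q a * g a < c -> 0 < d ->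
  \forall n \near \oo, expR (- (n%:R * (KL Q P + d))) <=
    \sum_(x : n.-tuple X | (\sum_(a <- x) g a) / n%:R < c) prodP P x.
Proof.
move=> gc d0; have Q_ge0 a : 0 <= Q a by exact: ltW.
have d2 : 0 < d / 2 by rewrite divr_gt0.
have e4 : 0 < 4^-1 :> R by rewrite invr_gt0.
pose h a := ln (Q a / P a).
have c0 : 0 < c - \sum_a Q a * g a by rewrite subr_gt0.
have hA := weak_law g Q_ge0 Q_sum1 c0 e4.
have hB := weak_law h Q_ge0 Q_sum1 d2 e4.
near=> n.
have n0 : 0 < n%:R :> R by rewrite ltr0n; near: n; exact: nbhs_infty_gt.
have nd : 1 < n%:R * (d / 2).
  by rewrite mulrC -ltr_pdivrMl// mulr1; near: n; exact: nbhs_infty_gtr.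
have pA : \sum_(x : n.-tuple X | c <= (\sum_(a <- x) g a) / n%:R) prodP Q x <= 4^-1.
  by near: n; move: hA; rewrite addrC subrK.
have pB : \sum_(x : n.-tuple X | KL Q P + d / 2 <= (\sum_(a <- x) h a) / n%:R)
    prodP Q x <= 4^-1.
  by near: n; exact: hB.
have half : 2^-1 <= \sum_(x : n.-tuple X |
    ((\sum_(a <- x) g a) / n%:R < c) && ((\sum_(a <- x) h a) / n%:R < KL Q P + d / 2))
    prodP Q x.
  have := sum_prodP1 Q_sum1 n.
  suff : \sum_(x : n.-tuple X) prodP Q x <=
    \sum_(x : n.-tuple X |
    ((\sum_(a <- x) g a) / n%:R < c) && ((\sum_(a <- x) h a) / n%:R < KL Q P + d / 2))
    prodP Q x +
    (\sum_(x : n.-tuple X | c <= (\sum_(a <- x) g a) / n%:R) prodP Q x +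
     \sum_(x : n.-tuple X | KL Q P + d / 2 <= (\sum_(a <- x) h a) / n%:R) prodP Q x).
    by lra.
  rewrite [X in _ <= X + (_ + _)]big_mkcond [X in _ <= _ + (X + _)]big_mkcond.
  rewrite [X in _ <= _ + (_ + X)]big_mkcond -!big_split /=; apply: ler_sum => x _.
  have px := prodP_ge0 Q_ge0 x.
  by case: ltP => _; case: ltP => _ /=; lra.
apply: (@le_trans _ _ (expR (- (n%:R * (KL Q P + d / 2))) * 2^-1)).
  have -> : - (n%:R * (KL Q P + d)) = - (n%:R * (KL Q P + d / 2)) + - (n%:R * (d / 2)).
    by field.
  rewrite expRD ler_pM2l ?expR_gt0// expRN lef_pV2 ?posrE ?expR_gt0//.
  by have := expR_ge1Dx (n%:R * (d / 2)); lra.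
apply: le_trans (ler_wpM2l (expR_ge0 _) half) _.
rewrite mulr_sumr big_mkcond [leRHS]big_mkcond /=; apply: ler_sum => x _.
have px := prodP_ge0 (fun a => ltW (P_gt0 a)) x.
case: ltP => _ //=; case: ltP => // hx.
rewrite prodP_density mulrC ler_wpM2l ?prodP_ge0// ler_expR lerN2.
by rewrite mulrC -ler_pdivrMr// ltW.
Unshelve. all: by end_near. Qed.

End ChangeOfMeasure.

(** * Exponential tilting *)

Section Tilt.
Variables (R : realType) (X : finType) (P u : X -> R) (a0 : X).
Hypothesis P_gt0 : forall a, 0 < P a.
Hypothesis P_sum1 : \sum_a P a = 1.
Hypothesis u_neg : u a0 < 0.

Definition tilt_mass (l : R) : R := \sum_a P a * expR (- (l * u a)).
Definition tilt (l : R) (a : X) : R := P a * expR (- (l * u a)) / tilt_mass l.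

Lemma tilt_mass_gt0 l : 0 < tilt_mass l.
Proof.
rewrite /tilt_mass (bigD1 a0)//= ltr_wpDr ?mulr_gt0 ?expR_gt0//.
by apply: sumr_ge0 => a _; rewrite mulr_ge0 ?expR_ge0// ltW.
Qed.

Lemma tilt_gt0 l a : 0 < tilt l a.
Proof. by rewrite /tilt !mulr_gt0 ?expR_gt0 ?invr_gt0 ?tilt_mass_gt0. Qed.

Lemma sum_tilt l : \sum_a tilt l a = 1.
Proof. by rewrite -mulr_suml mulfV// lt0r_neq0 ?tilt_mass_gt0. Qed.

Lemma full_dist_tilt l : full_dist (tilt l).
Proof. by split; [exact: tilt_gt0|exact: sum_tilt]. Qed.

Lemma ln_tilt l a : ln (tilt l a / P a) = - (l * u a) - ln (tilt_mass l).
Proof.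
have -> : tilt l a / P a = expR (- (l * u a)) / tilt_mass l.
  by rewrite /tilt; field; rewrite !lt0r_neq0 ?tilt_mass_gt0.
by rewrite ln_div ?posrE ?expR_gt0 ?tilt_mass_gt0// expRK.
Qed.

(** Minus the derivative of [tilt_mass]; it has the sign of the mean of u under the tilt. *)
Let slope (l : R) : R := \sum_a P a * u a * expR (- (l * u a)).

Let mean_tilt l : \sum_a tilt l a * u a = slope l / tilt_mass l.
Proof. by rewrite mulr_suml; apply: eq_bigr => a _; rewrite /tilt; ring. Qed.

(** Every term is at most P a / l, because x exp (- x) <= 1, while the term at [a0] stays below P u
    = - k. With l = 2 / k the other terms sum to at most k / 2. *)
Let slope_neg : exists2 l, 0 <= l & slope l < 0.
Proof.
pose k := - (P a0 * u a0).
have k0 : 0 < k by rewrite oppr_gt0 pmulr_rlt0.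
pose l := 2 / k; have l0 : 0 < l by rewrite divr_gt0.
exists l; first exact: ltW.
have h a : P a * u a * expR (- (l * u a)) <= P a / l.
  rewrite -mulrA ler_pM2l//.
  have [ua|ua] := leP (u a) 0.
    by rewrite (@le_trans _ _ 0) ?mulr_le0_ge0 ?expR_ge0// invr_ge0 ltW.
  have /(ler_wpM2r (expR_ge0 (- (l * u a)))) := expR_ge1Dx (l * u a).
  rewrite -expRD subrr expR0 => h1.
  rewrite -[leRHS]mul1r ler_pdivlMr//; apply: le_trans h1.
  rewrite mulrAC ler_wpM2r ?expR_ge0// mulrC; lra.
have ha0 : P a0 * u a0 * expR (- (l * u a0)) <= P a0 * u a0.
  have nPu : P a0 * u a0 < 0 by rewrite pmulr_rlt0.
  rewrite -[leRHS]mulr1 (ler_wnM2l (ltW nPu))//.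
  by rewrite ltW// expR_gt1 oppr_gt0 pmulr_rlt0.
rewrite /slope (bigD1 a0)//= (le_lt_trans (lerD ha0 (ler_sum _ (fun a _ => h a))))//.
rewrite -mulr_suml -ltrBrDl sub0r -/k ltr_pdivrMr// /l mulrC divfK ?lt0r_neq0//.
rewrite (@le_lt_trans _ _ 1) ?ltr1n// -P_sum1 [leRHS](bigD1 a0)//= lerDr.
exact: ltW.
Qed.

Lemma tilt_negative_mean : exists2 l, 0 <= l & \sum_a tilt l a * u a < 0.
Proof.
have [l l0 sl] := slope_neg; exists l => //.
by rewrite mean_tilt pmulr_llt0 ?invr_gt0 ?tilt_mass_gt0.
Qed.

Let continuous_slope : continuous slope.
Proof.
apply: continuous_big => [|a _ l]; first exact: add_continuous.
apply: cvgM; first exact: cvg_cst.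
apply: continuous_comp; last exact: continuous_expR.
by apply: cvgN; apply: cvgM; [exact: cvg_id|exact: cvg_cst].
Qed.

(** Complementary slackness: either P itself meets the constraint and l = 0, or the slope is
    positive at 0 and negative further on, hence vanishes in between. *)
Lemma tilt_optimal : exists2 l, 0 <= l &
  \sum_a tilt l a * u a <= 0 /\ l * (\sum_a tilt l a * u a) = 0.
Proof.
have [s0|s0] := leP (slope 0) 0.
  exists 0 => //; split; last exact: mul0r.
  by rewrite mean_tilt pmulr_lle0 ?invr_gt0 ?tilt_mass_gt0.
have [l l0 sl] := slope_neg.
have [|k] := @IVT R slope 0 l 0 l0 (continuous_subspaceT continuous_slope).
  by rewrite ge_min le_max (ltW s0) (ltW sl) orbT.
rewrite in_itv /= => /andP[k0 _] sk; exists k => //.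
by rewrite mean_tilt sk mul0r mulr0.
Qed.

Lemma KL_tilt l : l * (\sum_a tilt l a * u a) = 0 -> KL (tilt l) P = - ln (tilt_mass l).
Proof.
move=> h; rewrite /KL; under eq_bigr do rewrite ln_tilt mulrBr.
rewrite sumrB -mulr_suml sum_tilt mul1r.
have -> : \sum_a tilt l a * - (l * u a) = - (l * \sum_a tilt l a * u a).
  by rewrite mulr_sumr -sumrN; apply: eq_bigr => a _; ring.
by rewrite h oppr0 sub0r.
Qed.

(** Weak duality: KL Q P splits into the relative entropy of Q to the tilt, bounded below termwise
    by Q - tilt of total 0, and the mean of ln (tilt / P), where the multiplier contributes - l
    E_Q[u] >= 0. *)
Lemma KL_ge_tilt l (Q : X -> R) : 0 <= l -> is_dist Q -> \sum_a Q a * u a <= 0 ->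
  - ln (tilt_mass l) <= KL Q P.
Proof.
move=> l0 [Q0 Q1] Qu.
have : \sum_a (Q a * (- (l * u a) - ln (tilt_mass l)) + (Q a - tilt l a)) <= KL Q P.
  apply: ler_sum => a _; rewrite -ln_tilt.
  have := Q0 a; rewrite le_eqVlt => /predU1P[<-|Qa].
    by rewrite !mul0r add0r sub0r oppr_le0 ltW// tilt_gt0.
  have -> : Q a - tilt l a = - (Q a * (tilt l a / Q a - 1)).
    by field; rewrite lt0r_neq0.
  rewrite lerBlDr -lerBlDl -mulrBr ler_pM2l//.
  have T0 := tilt_gt0 l a.
  rewrite -ln_div; try by rewrite posrE divr_gt0.
  have -> : tilt l a / P a / (Q a / P a) = 1 + (tilt l a / Q a - 1).
    by field; rewrite !lt0r_neq0.
  by rewrite le_ln1Dx// ltrBrDl subrr divr_gt0.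
rewrite big_split /= sumrB Q1 sum_tilt subrr addr0.
under eq_bigr do rewrite mulrBr; rewrite sumrB -mulr_suml Q1 mul1r.
apply: le_trans; rewrite -[leLHS]add0r lerB//.
have -> : \sum_a Q a * - (l * u a) = - (l * \sum_a Q a * u a).
  by rewrite mulr_sumr -sumrN; apply: eq_bigr => a _; ring.
by rewrite oppr_ge0 mulr_ge0_le0.
Qed.

(* Mixing a little of a distribution with negative mean into the optimal tilt
   makes the constraint strict; concavity of ln controls the cost. *)
Lemma KL_near_tilt l (d : R) : 0 <= l -> \sum_a tilt l a * u a <= 0 ->
  l * (\sum_a tilt l a * u a) = 0 -> 0 < d ->
  exists2 Q, full_dist Q & \sum_a Q a * u a < 0 /\ KL Q P <= - ln (tilt_mass l) + d.
Proof.
move=> l0 mu0 slack d0.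
have [k k0 nk] := tilt_negative_mean.
set S := tilt l in mu0 slack *; set T := tilt k in nk *.
have S0 : forall a, 0 < S a := tilt_gt0 l.
have T0 : forall a, 0 < T a := tilt_gt0 k.
(* Cost per unit of mixing weight t: the sum comes from ln (1 + x) <= x and Q <= 1, the other
   summand from the linear term - l u, which slackness removes for [S]. *)
pose K := \sum_a T a / S a + l * - (\sum_a T a * u a).
have K0 : 0 <= K.
  rewrite addr_ge0//; last by rewrite mulr_ge0// oppr_ge0 ltW.
  by apply: sumr_ge0 => a _; rewrite divr_ge0 ?ltW.
pose t := Num.min 2^-1 (d / (K + 1)).
have t0 : 0 < t by rewrite lt_min invr_gt0 ltr0n divr_gt0// ltr_wpDl.
have t1 : t <= 2^-1 by rewrite ge_min lexx.
have tK : t * K <= d.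
  have : t <= d / (K + 1) by rewrite ge_min lexx orbT.
  by rewrite ler_pdivlMr ?ltr_wpDl// mulrDr mulr1; lra.
have t1' : 0 < 1 - t by lra.
pose Q a := (1 - t) * S a + t * T a.
have Q0 a : 0 < Q a by apply: addr_gt0; exact: mulr_gt0.
have sumQ (f : X -> R) : \sum_a Q a * f a = (1 - t) * (\sum_a S a * f a) + t * (\sum_a T a * f a).
  by rewrite !mulr_sumr -big_split; apply: eq_bigr => a _; rewrite /Q /=; ring.
have Q1 : \sum_a Q a = 1.
  by rewrite big_split /= -!mulr_sumr !sum_tilt; ring.
have Qle1 a : Q a <= 1.
  by rewrite -Q1 (bigD1 a)//= lerDl sumr_ge0// => b _; exact: ltW.
exists Q; first by split.
split.
  have h1 : (1 - t) * (\sum_a S a * u a) <= 0 by rewrite pmulr_rle0.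
  have h2 : t * (\sum_a T a * u a) < 0 by rewrite pmulr_rlt0.
  by rewrite sumQ; lra.
have bnd a : Q a * ln (Q a / P a) <= Q a * (- (l * u a) - ln (tilt_mass l)) + t * (T a / S a).
  have x0 : 0 < t * (T a / S a) by rewrite mulr_gt0// divr_gt0.
  have y0 : 0 < 1 + t * (T a / S a) by exact: addr_gt0.
  have z0 : 0 < S a / P a by exact: divr_gt0.
  have w0 : 0 < Q a / P a by exact: divr_gt0.
  have yz0 : 0 < S a / P a * (1 + t * (T a / S a)) by exact: mulr_gt0.
  have le1 : ln (Q a / P a) <= ln (S a / P a) + t * (T a / S a).
    have ub : Q a / P a <= S a / P a * (1 + t * (T a / S a)).
      have -> : S a / P a * (1 + t * (T a / S a)) = (S a + t * T a) / P a.
        by move: (S0 a) (P_gt0 a) => /lt0r_neq0 ? /lt0r_neq0 ?; field; apply/andP.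
      rewrite ler_pM2r ?invr_gt0// /Q lerD2r ler_piMl ?(ltW (S0 a))//; lra.
    apply: (@le_trans _ _ (ln (S a / P a * (1 + t * (T a / S a))))).
      by rewrite ler_ln.
    rewrite lnM// lerD2l le_ln1Dx//.
    by rewrite (lt_trans _ x0)// oppr_lt0.
  rewrite -ln_tilt -/S; apply: le_trans (ler_wpM2l (ltW (Q0 a)) le1) _.
  by rewrite mulrDr lerD2l ler_piMl// ltW.
apply: le_trans (ler_sum _ (fun a _ => bnd a)) _.
rewrite big_split /= -mulr_sumr.
have -> : \sum_a Q a * (- (l * u a) - ln (tilt_mass l)) =
    - (l * (\sum_a Q a * u a)) - ln (tilt_mass l).
  under eq_bigr do rewrite mulrBr; rewrite sumrB -mulr_suml Q1 mul1r; congr (_ - _).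
  by rewrite mulr_sumr -sumrN; apply: eq_bigr => a _; ring.
have st : t * (l * (\sum_a S a * u a)) = 0 by rewrite slack mulr0.
rewrite sumQ; move: tK; rewrite /K.
move: slack st; set s := \sum_a S a * u a; set s' := \sum_a T a * u a.
set q := \sum_a T a / S a; lra.
Qed.

End Tilt.

(** * The mismatched test *)

Section LimSup.
Variable R : realType.
Implicit Types (u : nat -> \bar R) (c : \bar R).

Lemma limn_esup_le_near u c : (\forall n \near \oo, (u n <= c)%E) -> (limn_esup u <= c)%E.
Proof.
move=> h; rewrite /limn_esup limf_esupE.
apply: (@le_trans _ _ (ereal_sup (u @` [set n | (u n <= c)%E]))).
  by apply: ereal_inf_lbound; exists [set n | (u n <= c)%E].
by apply: ge_ereal_sup => _ [n /= hn <-].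
Qed.

Lemma limn_esup_lt_near u c : (limn_esup u < c)%E -> \forall n \near \oo, (u n < c)%E.
Proof.
rewrite /limn_esup limf_esupE => /ereal_inf_lt[_ [V hV <-]] hc.
apply: filterS hV => n Vn; apply: le_lt_trans hc.
by apply: ereal_sup_ubound; exists n.
Qed.

Lemma limn_einf_ge_near u c : (\forall n \near \oo, (c <= u n)%E) -> (c <= limn_einf u)%E.
Proof.
move=> h; rewrite /limn_einf leeNr; apply: limn_esup_le_near.
by apply: filterS h => n; rewrite leeN2.
Qed.

Lemma limn_einf_le_near u c : (\forall n \near \oo, (u n <= c)%E) -> (limn_einf u <= c)%E.
Proof. by move=> h; apply: le_trans (limn_einf_sup u) (limn_esup_le_near h). Qed.

End LimSup.

(** * Types, and differences of relative entropies as linear functionals *)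

Section Types.
Variables (R : realType) (X : finType).

Lemma sum_etype n (x : n.-tuple X) (f : X -> R) :
  \sum_a etype R x a * f a = (\sum_(a <- x) f a) / n%:R.
Proof.
rewrite mulr_suml; under eq_bigr do rewrite /etype mulrAC.
rewrite -!mulr_suml; congr (_ / _).
elim: (tval x) => [|b s IH]; first by rewrite big_nil big1// => a _; rewrite mul0r.
rewrite big_cons -IH /=.
under eq_bigr do rewrite natrD mulrDl.
rewrite big_split /=; congr (_ + _).
rewrite (bigD1 b)//= eqxx mul1r big1 ?addr0// => a ab.
by rewrite eq_sym (negbTE ab) mul0r.
Qed.

(** The terms Q ln Q cancel, leaving a linear function of Q; this turns both the test and the
    constraint set into half-spaces. *)
Lemma KL_sub (Q A B : X -> R) : (forall a, 0 <= Q a) ->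
  (forall a, 0 < A a) -> (forall a, 0 < B a) ->
  KL Q A - KL Q B = \sum_a Q a * ln (B a / A a).
Proof.
move=> Q0 A0 B0; rewrite /KL -sumrB; apply: eq_bigr => a _.
have := Q0 a; rewrite le_eqVlt => /predU1P[<-|Qa]; first by rewrite !mul0r subrr.
by rewrite -mulrBr !ln_div ?posrE//; congr (_ * _); ring.
Qed.

Lemma KL_sub_shift (Q A B : X -> R) (c : R) : is_dist Q ->
  (forall a, 0 < A a) -> (forall a, 0 < B a) ->
  KL Q A - KL Q B = \sum_a Q a * (ln (B a / A a) - c) + c.
Proof.
move=> [Q0 Q1] A0 B0; rewrite KL_sub//.
under [in RHS]eq_bigr do rewrite mulrBr.
by rewrite sumrB -mulr_suml Q1 mul1r subrK.
Qed.

End Types.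

(** * Converse and achievability for the mismatched test *)

Section Mismatched.
Variables (R : realType) (X : finType) (P0 P1 Ph0 Ph1 : X -> R) (eps : R).
Hypothesis fP0 : full_dist P0.
Hypothesis fP1 : full_dist P1.
Hypothesis fPh0 : full_dist Ph0.
Hypothesis fPh1 : full_dist Ph1.
Hypothesis eps_half : 0 < eps < 1 / 2.
Hypothesis V_gt0 : 0 < Vdisp P0 Ph0 Ph1.

Let g (a : X) : R := ln (Ph1 a / Ph0 a).
Let gs : R := KL P0 Ph0 - KL P0 Ph1.
Let u (a : X) : R := g a - gs.

Let P0_ge0 a : 0 <= P0 a. Proof. by apply: ltW; case: fP0. Qed.

Let gsE : gs = \sum_a P0 a * g a.
Proof. by rewrite /gs KL_sub//; [case: fPh0|case: fPh1]. Qed.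

Let decide1E c n (x : n.-tuple X) :
  decide1 Ph0 Ph1 c x = (c <= (\sum_(a <- x) g a) / n%:R).
Proof.
rewrite /decide1 KL_sub ?sum_etype//; [|by case: fPh0|by case: fPh1].
by move=> a; rewrite divr_ge0.
Qed.

Let VE : Vdisp P0 Ph0 Ph1 = \sum_a P0 a * (g a - \sum_b P0 b * g b) ^+ 2.
Proof.
have gN a : ln (Ph0 a / Ph1 a) = - g a.
  by rewrite /g !ln_div ?posrE ?opprB//; [case: fPh1|case: fPh0|case: fPh0|case: fPh1].
rewrite /Vdisp; apply: eq_bigr => a _; rewrite gN.
under eq_bigr do rewrite gN mulrN.
by rewrite sumrN; ring.
Qed.

(** [u] has mean 0 under P0; were it nonnegative, every P0 u would vanish, against the positive
    variance. Such a letter makes the constraint strictly feasible by tilting. *)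
Let u_neg : exists a, u a < 0.
Proof.
apply/not_existsP => h.
have u0 a : 0 <= u a by rewrite leNgt; apply/negP; exact: h.
have : \sum_a P0 a * u a = 0.
  under eq_bigr do rewrite mulrBr.
  by rewrite sumrB -mulr_suml (proj2 fP0) mul1r -gsE subrr.
move=> /eqP; rewrite psumr_eq0; last by move=> a _; rewrite mulr_ge0.
move=> /allP z; move: V_gt0; rewrite VE -gsE big1 ?ltxx// => a _.
have /eqP := z a (mem_index_enum a); rewrite -/(u a) expr2 mulrA => ->.
by rewrite mul0r.
Qed.

(** If gam n <= c, deciding 0 forces the mean of g below c < gs, which has P0-probability at most
    1/4 for large n. Then [err0] is at least 3/4, whereas admissibility with eps < 1/2 keeps it
    eventually below 1/2. *)
Lemma admissible_threshold_gt gam (c : R) : admissible P0 Ph0 Ph1 eps gam ->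
  c < gs -> \forall n \near \oo, c < gam n.
Proof.
move=> adm cg; have [e0 e1] := andP eps_half.
have lt1 : (limn_esup (fun n => (err0 P0 Ph0 Ph1 (gam n) n)%:E) < (1 / 2)%:E)%E.
  by apply: le_lt_trans adm _; rewrite lte_fin.
have h1 := limn_esup_lt_near lt1.
have d0 : 0 < gs - c by rewrite subr_gt0.
have e4 : 0 < 4^-1 :> R by rewrite invr_gt0.
(* [weak_law] bounds upper tails; the lower tail of g is the upper tail of - g. *)
have h2 := weak_law (fun a => - g a) P0_ge0 (proj2 fP0) d0 e4.
have mN : \sum_a P0 a * - g a + (gs - c) = - c.
  by under eq_bigr do rewrite mulrN; rewrite sumrN -gsE; ring.
near=> n; rewrite ltNge; apply/negP => gc.
have : err0 P0 Ph0 Ph1 (gam n) n < 1 / 2 by rewrite -lte_fin; near: n; exact: h1.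
have : \sum_(x : n.-tuple X | - c <= (\sum_(a <- x) - g a) / n%:R) prodP P0 x <= 4^-1.
  by near: n; move: h2; rewrite mN.
have := sum_prodP1 (proj2 fP0) n.
suff : \sum_(x : n.-tuple X) prodP P0 x <= err0 P0 Ph0 Ph1 (gam n) n +
    \sum_(x : n.-tuple X | - c <= (\sum_(a <- x) - g a) / n%:R) prodP P0 x by lra.
rewrite /err0 [X in _ <= X + _]big_mkcond [X in _ <= _ + X]big_mkcond -big_split /=.
apply: ler_sum => x _; have px := prodP_ge0 P0_ge0 x.
rewrite decide1E sumrN mulNr lerN2.
case: (leP (gam n)) => h; first by case: ifP => _; lra.
by rewrite ifT ?add0r//; apply: ltW (lt_le_trans h gc).
Unshelve. all: by end_near. Qed.

Lemma err1_ge gam (Q : X -> R) (d : R) : admissible P0 Ph0 Ph1 eps gam ->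
  full_dist Q -> \sum_a Q a * u a < 0 -> 0 < d ->
  \forall n \near \oo, expR (- (n%:R * (KL Q P1 + d))) <= err1 P1 Ph0 Ph1 (gam n) n.
Proof.
move=> adm [Q0 Q1] Qu d0.
have Qg : \sum_a Q a * u a = \sum_a Q a * g a - gs.
  by under eq_bigr do rewrite mulrBr; rewrite sumrB -mulr_suml Q1 mul1r.
pose c := (\sum_a Q a * g a + gs) / 2.
have h1 : \forall n \near \oo, c < gam n by apply: admissible_threshold_gt => //; rewrite /c; lra.
have Qc : \sum_a Q a * g a < c by rewrite /c; lra.
have h2 := lower_tail_ge (proj1 fP1) Q0 Q1 Qc d0.
near=> n; have cn : c < gam n by near: n; exact: h1.
apply: (@le_trans _ _ (\sum_(x : n.-tuple X | (\sum_(a <- x) g a) / n%:R < c) prodP P1 x)).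
  by near: n; exact: h2.
rewrite /err1 big_mkcond [leRHS]big_mkcond /=; apply: ler_sum => x _.
have px := prodP_ge0 (fun a => ltW (proj1 fP1 a)) x.
by rewrite decide1E -ltNge; case: ltP => h; [rewrite (lt_trans h cn)|case: ifP].
Unshelve. all: by end_near. Qed.

Lemma exponent1_le gam (Q : X -> R) : admissible P0 Ph0 Ph1 eps gam ->
  full_dist Q -> \sum_a Q a * u a < 0 -> (exponent1 P1 Ph0 Ph1 gam <= (KL Q P1)%:E)%E.
Proof.
move=> adm fQ Qu; apply/lee_addgt0Pr => d d0; rewrite -EFinD.
apply: limn_einf_le_near; have h := err1_ge adm fQ Qu d0.
near=> n; rewrite lee_fin.
have n0 : 0 < n%:R :> R by rewrite ltr0n; near: n; exact: nbhs_infty_gt.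
have hn : expR (- (n%:R * (KL Q P1 + d))) <= err1 P1 Ph0 Ph1 (gam n) n.
  by near: n; exact: h.
have e0 : 0 < err1 P1 Ph0 Ph1 (gam n) n by apply: lt_le_trans hn; exact: expR_gt0.
rewrite mulNr lerNl mulrC ler_pdivlMr// mulrC mulrN -[leLHS]expRK ler_ln ?posrE//.
exact: expR_gt0.
Unshelve. all: by end_near. Qed.

Let gam (n : nat) : R := gs + Num.sqrt (Vdisp P0 Ph0 Ph1 / n%:R) * gaussQinv eps.

Lemma admissible_gaussian_threshold : admissible P0 Ph0 Ph1 eps gam.
Proof.
have [e0 e1] := andP eps_half.
have e01 : 0 < eps < 1 by rewrite e0/=; lra.
rewrite /admissible; apply/lee_addgt0Pr => d d0; rewrite -EFinD.
apply: limn_esup_le_near.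
have V0 : 0 < \sum_a P0 a * (g a - \sum_b P0 b * g b) ^+ 2 by rewrite -VE.
have := clt_upper P0_ge0 (proj2 fP0) V0 (gaussQinv eps) d0.
rewrite -VE -gsE gaussQ_gaussQinv//; apply: filterS => n.
rewrite lee_fin /err0; apply: le_trans.
by rewrite le_eqVlt; apply/orP; left; apply/eqP; apply: eq_bigl => x; rewrite decide1E.
Qed.

Lemma exponent1_ge (l : R) : 0 <= l ->
  ((- ln (tilt_mass P1 u l))%:E <= exponent1 P1 Ph0 Ph1 gam)%E.
Proof.
move=> l0; apply/lee_addgt0Pr => d d0.
have [a0 ua0] := u_neg.
have Z0 := tilt_mass_gt0 u a0 (proj1 fP1) l.
(* A threshold excess below d / (l + 1) costs at most l d / (l + 1) <= d in the Chernoff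
   exponent. *)
have dl0 : 0 < d / (l + 1) by rewrite divr_gt0// ltr_wpDl.
have h1 := near_mul_sqrt_lt (gaussQinv eps) (ltW V_gt0) dl0.
(* This lower bound serves only to make [err1] positive: with [ln 0 = 0], a vanishing error would
   give exponent 0. *)
have [k k0 Tk] := tilt_negative_mean (proj1 fP1) (proj2 fP1) ua0.
have h2 := err1_ge admissible_gaussian_threshold (full_dist_tilt u a0 (proj1 fP1) k) Tk ltr01.
rewrite -leeBlDr// -EFinB; apply: limn_einf_ge_near; near=> n; rewrite lee_fin.
have nN : (0 < n)%N by near: n; exact: nbhs_infty_gt.
have n0 : 0 < n%:R :> R by rewrite ltr0n.
have gn : gam n < gs + d / (l + 1).
  by rewrite /gam ltrD2l mulrC; near: n; exact: h1.
have e0 : 0 < err1 P1 Ph0 Ph1 (gam n) n.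
  apply: (@lt_le_trans _ _ (expR (- (n%:R * (KL (tilt P1 u k) P1 + 1))))).
    exact: expR_gt0.
  by near: n; exact: h2.
have P1_ge0 a : 0 <= P1 a by exact: ltW (proj1 fP1 a).
have ch := chernoff_lower u P1_ge0 (d / (l + 1)) nN l0.
have : err1 P1 Ph0 Ph1 (gam n) n <= expR (n%:R * (d + ln (tilt_mass P1 u l))).
  apply: le_trans (le_trans ch _).
    rewrite /err1 big_mkcond [leRHS]big_mkcond /=; apply: ler_sum => x _.
    have px := prodP_ge0 P1_ge0 x.
    rewrite decide1E -ltNge; case: ltP => h; last by case: ifP.
    rewrite ifT// sumrB big_const_seq count_predT size_tuple iter_addr_0.
    by rewrite -(mulr_natr gs) mulrBl mulfK ?lt0r_neq0// ltrBlDl (lt_trans h).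
  rewrite mulrDr expRD; apply: ler_pM.
  - exact: expR_ge0.
  - exact/exprn_ge0/ltW/Z0.
  - rewrite ler_expR ler_pM2l// mulrCA; apply: ler_piMr; first exact: ltW.
    by rewrite ler_pdivrMr ?ltr_wpDl// mul1r lerDl.
  - by rewrite expRM_natl lnK ?posrE.
rewrite -ler_ln ?posrE ?expR_gt0// expRK => h.
by rewrite mulNr lerNr opprB opprK mulrC ler_pdivrMr// mulrC.
Unshelve. all: by end_near. Qed.

Lemma stein_mismatched :
  exists2 Qs, is_dist Qs /\ \sum_a Qs a * u a <= 0 &
  [/\ forall Q, is_dist Q -> \sum_a Q a * u a <= 0 -> KL Qs P1 <= KL Q P1,
   forall gam', admissible P0 Ph0 Ph1 eps gam' ->
     (exponent1 P1 Ph0 Ph1 gam' <= (KL Qs P1)%:E)%E &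
   exponent1 P1 Ph0 Ph1 gam = (KL Qs P1)%:E].
Proof.
have [a0 ua0] := u_neg.
have [P1_gt0 P1_sum1] := fP1.
have [l l0 [ml sl]] := tilt_optimal P1_gt0 P1_sum1 ua0.
have KLE := KL_tilt a0 P1_gt0 sl.
have upper gam' : admissible P0 Ph0 Ph1 eps gam' ->
    (exponent1 P1 Ph0 Ph1 gam' <= (KL (tilt P1 u l) P1)%:E)%E.
  move=> adm; apply/lee_addgt0Pr => d d0; rewrite KLE -EFinD.
  have [Q fQ [Qu KQ]] := KL_near_tilt P1_gt0 P1_sum1 ua0 l0 ml sl d0.
  by apply: le_trans (exponent1_le adm fQ Qu) _; rewrite lee_fin.
exists (tilt P1 u l).
  split=> //; split; last by case: (full_dist_tilt u a0 P1_gt0 l).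
  by move=> a; apply: ltW; exact: tilt_gt0.
split=> //; first by move=> Q dQ Qu; rewrite KLE; exact: (KL_ge_tilt a0).
apply/eqP; rewrite eq_le upper ?KLE ?exponent1_ge//.
exact: admissible_gaussian_threshold.
Qed.

End Mismatched.

Theorem theorem2 (R : realType) (X : finType) (P0 P1 Ph0 Ph1 : X -> R) (eps : R) :
  full_dist P0 -> full_dist P1 -> full_dist Ph0 -> full_dist Ph1 ->
  0 < eps < 1 / 2 ->
  0 < Vdisp P0 Ph0 Ph1 ->
  let gstar := KL P0 Ph0 - KL P0 Ph1 in
  let Q1 := [set Q : X -> R | is_dist Q /\ KL Q Ph0 - KL Q Ph1 <= gstar] in
  (exists2 Qs, Q1 Qs &
     (forall Q, Q1 Q -> KL Qs P1 <= KL Q P1) /\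
     stein_exp P0 P1 Ph0 Ph1 eps = (KL Qs P1)%:E) /\
  let gam := fun n : nat =>
    gstar + Num.sqrt (Vdisp P0 Ph0 Ph1 / n%:R) * gaussQinv eps in
  admissible P0 Ph0 Ph1 eps gam /\
  exponent1 P1 Ph0 Ph1 gam = stein_exp P0 P1 Ph0 Ph1 eps.
Proof.
move=> fP0 fP1 fPh0 fPh1 he hV gstar Q1 /=.
have adm := admissible_gaussian_threshold fP0 fPh0 fPh1 he hV.
have [Qs [dQs Qsu] [Qmin upper attained]] := stein_mismatched fP0 fP1 fPh0 fPh1 he hV.
have Q1E Q : is_dist Q -> KL Q Ph0 - KL Q Ph1 =
    \sum_a Q a * (ln (Ph1 a / Ph0 a) - gstar) + gstar.
  by move=> dQ; apply: KL_sub_shift => //; [case: fPh0|case: fPh1].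
have steinE : stein_exp P0 P1 Ph0 Ph1 eps = (KL Qs P1)%:E.
  apply/eqP; rewrite eq_le; apply/andP; split.
    by apply: ge_ereal_sup => _ [gam' adm' <-]; exact: upper.
  by rewrite -attained; apply: ereal_sup_ubound; exact: imageP.
split; last by split=> //; rewrite steinE.
exists Qs; first by split=> //; rewrite Q1E// gerDr.
split=> // Q [dQ Qu]; apply: Qmin => //.
by move: Qu; rewrite Q1E// gerDr.
Qed.
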